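(* Let $d\ge2$, $A\in\mathcal C^{d-1}$ and $\tau\in(0,1]$. Then for every $C\in\mathcal C^d_A$, $$\tfrac{\tau}{2}\le\int_{\mathbb I^{d-1}}Q^\tau_C(\mathbf x)\,\mathrm d\mu_A(\mathbf x)\le\tfrac{\tau+1}{2},$$ and both bounds are best possible, i.e. $\inf_{C\in\mathcal C^d_A}\int Q^\tau_C\,\mathrm d\mu_A=\frac\tau2$ and $\sup_{C\in\mathcal C^d_A}\int Q^\tau_C\,\mathrm d\mu_A=\frac{\tau+1}2$.
   Context: $\mathbb I=[0,1]$, $\lambda$ Lebesgue measure. A $d$-copula $C\in\mathcal C^d$ is the distribution function on $\mathbb I^d$ of a probability measure $\mu_C$ with uniform univariate marginals; points are $(\mathbf x,y)$, $\mathbf x\in\mathbb I^{d-1}$. $C_{1:(d-1)}$ is the marginal copula of the first $d-1$ coordinates; $\mathcal C^d_A=\{C\in\mathcal C^d:C_{1:(d-1)}=A\}$ (for $d=2$, $\mu_A=\lambda$, $\mathcal C^2_A=\mathcal C^2$). $K_C$ is the Markov kernel of $C$ w.r.t. the first $d-1$ coordinates: $\mu_C(B\times F)=\int_B K_C(\mathbf x,F)\,\mathrm d\mu_{A}(\mathbf x)$ for $C\in\mathcal C^d_A$. The $\tau$-quantile regression function is $Q^\tau_C(\mathbf x)=\inf\{y\in\mathbb I: K_C(\mathbf x,[0,y])\ge\tau\}$. *)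

(* Defs.v *)
From HB Require Import structures.
From mathcomp Require Import all_boot all_order all_algebra.
From mathcomp Require Import all_classical all_reals all_analysis.
Set Implicit Arguments. Unset Strict Implicit. Unset Printing Implicit Defensive.
Import Order.TTheory GRing.Theory Num.Theory.
Local Open Scope classical_set_scope.
Local Open Scope ring_scope.
Local Open Scope ereal_scope.

(* Points of I^(n+1) are pairs (x, y) with x : n.-tuple R (coordinates 1..n,
   product Borel sigma-algebra) and y : R (last coordinate).  A copula is
   identified with its (doubly stochastic) probability measure mu_C; the
   "uniform marginal" condition is stated on all Borel sets of R, which in
   particular forces the support to lie in the unit cube. *)

Definition unifI (R : realType) (B : set R) : \bar R :=
  (@lebesgue_measure R) (B `&` `[0%R, 1%R]%classic).

Definition is_copula_measure (R : realType) (n : nat)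
    (mu : probability (n.-tuple R) R) : Prop :=
  forall (i : 'I_n) (B : set R), measurable B ->
    mu [set x | B (tnth x i)] = unifI B.

Definition is_copula_measure_pair (R : realType) (n : nat)
    (mu : probability (n.-tuple R * R)%type R) : Prop :=
  (forall (i : 'I_n) (B : set R), measurable B ->
     mu [set p | B (tnth p.1 i)] = unifI B) /\
  (forall B : set R, measurable B -> mu [set p | B p.2] = unifI B).

Definition in_copula_class (R : realType) (n : nat)
    (muA : probability (n.-tuple R) R)
    (muC : probability (n.-tuple R * R)%type R) : Prop :=
  is_copula_measure_pair muC /\
  forall B : set (n.-tuple R), measurable B ->
    muC (B `*` setT) = muA B.

Definition is_markov_kernel_of (R : realType) (n : nat)
    (muA : probability (n.-tuple R) R)
    (muC : probability (n.-tuple R * R)%type R)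
    (K : R.-pker (n.-tuple R) ~> R) : Prop :=
  (forall x, K x `[0%R, 1%R]%classic = 1) /\
  forall (B : set (n.-tuple R)) (F : set R), measurable B -> measurable F ->
    muC (B `*` F) = \int[muA]_(x in B) K x F.

Definition quantile_reg (R : realType) (n : nat)
    (K : R.-pker (n.-tuple R) ~> R) (tau : R) (x : n.-tuple R) : R :=
  inf [set y : R | (0 <= y <= 1)%R /\ tau%:E <= K x `[0%R, y]%classic].

Definition int_quantile (R : realType) (n : nat)
    (muA : probability (n.-tuple R) R)
    (K : R.-pker (n.-tuple R) ~> R) (tau : R) : \bar R :=
  \int[muA]_x (quantile_reg K tau x)%:E.

(* Main.v *)
(* Lower bound: K_C(x, [0, y]) >= tau whenever Q(x) < y, so Markov's inequality
   and the uniformity of the last marginal give P(Q < y) <= y / tau; integrating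
   the tail function gives E Q >= tau / 2.  The upper bound is the same argument
   for 1 - Q with 1 - tau in place of tau.

   Sharpness: for a < tau <= b, start from the independence copula and collapse
   the mass that the conditional law puts on [a, b] to the single point
   a + (b - a) x_i.  As x_i is uniform, the last marginal stays uniform, and now
   Q(x) = a + (b - a) x_i, whose mean is (a + b) / 2.  The infimum is attained
   by (a, b) = (0, tau); the supremum is approached by b = 1 and a -> tau. *)
Require Import Defs.
From HB Require Import structures.
From mathcomp Require Import all_boot all_order all_algebra.
From mathcomp Require Import all_classical all_reals all_analysis.
From mathcomp Require Import measurable_realfun ring lra.
Import Order.TTheory GRing.Theory Num.Theory.
Import numFieldNormedType.Exports.
Local Open Scope classical_set_scope.
Local Open Scope ring_scope.
Local Open Scope ereal_scope.

(** * Bounds on a mean from tail estimates *)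

Lemma integral_affine_decr (R : realType) (t : R) : (0 < t)%R ->
  \int[@lebesgue_measure R]_(y in `[0%R, t]) (1 - y / t)%:E = (t / 2)%:E.
Proof.
move=> t0.
pose F (y : R) : R := (y - y ^+ 2 / (t *+ 2))%R.
have dF (y : R) : is_derive y 1%R F (1 - y / t)%R.
  rewrite /F; apply: is_derive_eq.
  rewrite /GRing.scale/=.
  by field; rewrite gt_eqF.
have cF : continuous F.
  by move=> y; apply: differentiable_continuous; apply/derivable1_diffP; apply: ex_derive.
rewrite (@continuous_FTC2 R _ F 0 t t0).
- by rewrite -EFinB /F; congr EFin; field; rewrite gt_eqF.
- apply: continuous_subspaceT => y.
  apply: cvgB; first exact: cvg_cst.
  by apply: cvgM; [exact: cvg_id|exact: cvg_cst].
- split.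
  + by move=> y _; apply: ex_derive.
  + exact/cvg_at_right_filter/cF.
  + exact/cvg_at_left_filter/cF.
- by move=> y _; rewrite derive1E; apply: derive_val.
Qed.

Lemma measurable_lt_cst d (T : measurableType d) (R : realType) (X : T -> R)
    (y : R) :
  measurable_fun setT X -> measurable [set x | (X x < y)%R].
Proof.
by move=> mX; rewrite -preimage_itvNyo -[X in measurable X]setTI; exact: mX.
Qed.

Lemma measurable_le_cst d (T : measurableType d) (R : realType) (X : T -> R)
    (y : R) :
  measurable_fun setT X -> measurable [set x | (X x <= y)%R].
Proof.
by move=> mX; rewrite -preimage_itvNyc -[X in measurable X]setTI; exact: mX.
Qed.

(** The mean of [X] is the integral over r >= 0 of P(X > r). On [0, t] the hypothesis makes this
    tail at least 1 - r / t, and the tail beyond t is discarded. *)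
Lemma ge0_expectation_ge_half d (T : measurableType d) (R : realType)
    (P : probability T R) (X : T -> R) (t : R) :
    measurable_fun setT X -> (forall x, 0 <= X x)%R -> (0 < t)%R ->
    (forall y : R, (0 < y)%R -> t%:E * P [set x | (X x < y)%R] <= y%:E) ->
  (t / 2)%:E <= \int[P]_x (X x)%:E.
Proof.
move=> mX X0 t0 XP.
pose X' : {RV P >-> R} := HB.pack X (isMeasurableFun.Build _ _ _ _ X mX).
(* The hypothesis bounds the strict event, while the complement of the tail event is [X x <= y].
   Passing through y + e and letting e tend to 0 closes the gap and also covers y = 0. *)
have XleP (y : R) : (0 <= y)%R -> t%:E * P [set x | (X x <= y)%R] <= y%:E.
  move=> y0; apply/lee_addgt0Pr => e e0; rewrite -EFinD.
  apply: le_trans (XP (y + e)%R _); last lra.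
  rewrite lee_pmul2l ?lte_fin//; apply: le_measure; rewrite ?inE.
  - exact: measurable_le_cst.
  - exact: measurable_lt_cst.
  - by move=> x /= xy; lra.
have := @ge0_expectation_ccdf _ _ _ P X' X0.
rewrite expectation_def => ->.
rewrite -integral_affine_decr//.
apply: (@le_trans _ _ (\int[lebesgue_measure]_(r in `[0%R, t]) ccdf X' r)).
  apply: ge0_le_integral => //.
  - by move=> y /=; rewrite in_itv/= lee_fin subr_ge0 ler_pdivrMr// mul1r => /andP[].
  - apply/measurable_EFinP/measurable_funB => //.
    exact: measurable_funM.
  - apply: measurable_funTS; exact: ccdf_measurable.
  - move=> y /=; rewrite in_itv/= => /andP[y0 yt].
    rewrite ccdf_1_cdf /cdf /distribution /pushforward.
    have -> : X' @^-1` `]-oo, y] = [set x | (X x <= y)%R].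
      by apply/seteqP; split => x /=; rewrite in_itv.
    have := XleP y y0.
    rewrite -(@fineK _ (P [set x | (X x <= y)%R])) ?fin_num_measure//; last first.
      exact: measurable_le_cst.
    rewrite -EFinM -EFinB !lee_fin => H.
    by rewrite lerD2l lerN2 ler_pdivlMr// mulrC.
apply: ge0_subset_integral => //.
- apply: measurable_funTS; exact: ccdf_measurable.
- by apply: subset_itvl.
Qed.

(** Reflection: the previous lemma applies to 1 - X, and the means of X and 1 - X add up to 1. *)
Lemma expectation_le_half d (T : measurableType d) (R : realType)
    (P : probability T R) (X : T -> R) (t : R) :
    measurable_fun setT X -> (forall x, 0 <= X x <= 1)%R -> (0 < t)%R ->
    (forall y : R, (0 < y)%R -> t%:E * P [set x | (1 - X x < y)%R] <= y%:E) ->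
  \int[P]_x (X x)%:E <= (1 - t / 2)%:E.
Proof.
move=> mX X01 t0 XP.
have mX1 : measurable_fun setT (fun x => 1 - X x)%R by exact: measurable_funB.
have X1_ge0 x : (0 <= 1 - X x)%R by rewrite subr_ge0; case/andP: (X01 x).
have X_ge0 x : (0 <= X x)%R by case/andP: (X01 x).
have := ge0_expectation_ge_half _ _ _ P _ t mX1 X1_ge0 t0 XP.
have EX : \int[P]_x (X x)%:E + \int[P]_x (1 - X x)%:E = 1.
  rewrite -ge0_integralD//=; [|by move=> *; rewrite lee_fin|exact/measurable_EFinP
    |by move=> *; rewrite lee_fin|exact/measurable_EFinP].
  under eq_integral do rewrite -EFinD subrKC.
  by rewrite integral_cst//= probability_setT mule1.
move=> half; rewrite EFinB leeBrDr// -EX leeD2l//.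
Qed.

(** * Markov's inequality for the kernel *)

(** Disintegration over the whole space makes the mean of [K x F] equal to the [muC]-mass of the
    strip over [F], which is [unifI F] because the last marginal is uniform. *)
Lemma markov_kernel_ge (R : realType) (n : nat)
    (muA : probability (n.-tuple R) R)
    (muC : probability (n.-tuple R * R)%type R)
    (K : R.-pker (n.-tuple R) ~> R) (F : set R) (c : R) :
    in_copula_class muA muC -> is_markov_kernel_of muA muC K ->
    measurable F -> (0 < c)%R ->
  c%:E * muA [set x | c%:E <= K x F] <= unifI F.
Proof.
move=> [[_ uC] _] [_ CK] mF c0.
have mKF : measurable_fun setT (K ^~ F) := measurable_kernel K F mF.
have := le_integral_abse muA measurableT mKF c0.
rewrite setTI; under eq_set do rewrite gee0_abs//.
under eq_integral do rewrite gee0_abs//.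
rewrite -CK// -uC// => /le_trans; apply.
by rewrite (_ : _ `*` _ = [set p | F p.2])//; apply/seteqP; split => [x []|].
Qed.

(** The closed form serves the lower bound through [0, y]. The half-open form serves the upper bound
    through ]1 - y, 1], the complement of [0, 1 - y] in [0, 1]. *)
Lemma unifI_le_length (R : realType) (i : interval R) (x y : R) :
  (x <= y)%R -> i = `[x, y] \/ i = `]x, y] -> unifI [set` i] <= (y - x)%:E.
Proof.
move=> xy ixy; apply: (@le_trans _ _ (@lebesgue_measure R [set` i])).
  by apply: le_measure; rewrite ?inE//; exact: measurableI.
by rewrite lebesgue_measure_itv; case: ixy => ->/=; rewrite lte_fin; case: ifPn => //= _;
  rewrite -?EFinB lee_fin// subr_ge0.
Qed.

(** * The quantile function: order properties and measurability *)

Section Quantile.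
Context (R : realType) (n : nat) (K : R.-pker (n.-tuple R) ~> R) (tau : R).
Hypothesis tau01 : (0 < tau <= 1)%R.
Hypothesis K01 : forall x, K x `[0%R, 1%R]%classic = 1.

Local Notation Q := (quantile_reg K tau).
Local Notation Y x :=
  [set y : R | (0 <= y <= 1)%R /\ tau%:E <= K x `[0%R, y]%classic].

Lemma quantile_set1 x : Y x 1%R.
Proof. by split; rewrite ?ler01 ?lexx// K01 lee_fin; case/andP: tau01. Qed.

Lemma has_inf_quantile_set x : has_inf (Y x).
Proof.
split; first by exists 1%R; exact: quantile_set1.
by exists 0%R => y [/andP[]].
Qed.

Lemma quantile_ge0 x : (0 <= Q x)%R.
Proof.
apply: lb_le_inf; first by exists 1%R; exact: quantile_set1.
by move=> y [/andP[]].
Qed.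

Lemma quantile_le1 x : (Q x <= 1)%R.
Proof. by apply: ge_inf; [case: (has_inf_quantile_set x)|exact: quantile_set1]. Qed.

Lemma quantile_le x (y : R) : tau%:E <= K x `[0%R, y]%classic -> (Q x <= y)%R.
Proof.
move=> tauK; have [y1|y1] := leP y 1%R; last first.
  exact: le_trans (quantile_le1 x) (ltW y1).
(* For y < 0 the interval is empty, and its mass 0 cannot reach tau > 0. *)
have [y0|y0] := leP 0%R y; last first.
  move: tauK; rewrite set_itv_ge ?bnd_simp -?ltNge// measure0 lee_fin.
  by case/andP: tau01 => t0 _; rewrite leNgt t0.
by apply: ge_inf; [case: (has_inf_quantile_set x)|split; rewrite ?y0].
Qed.

Lemma le_kernel_itv x (y z : R) :
  (y <= z)%R -> K x `[0%R, y]%classic <= K x `[0%R, z]%classic.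
Proof.
move=> yz; apply: le_measure; rewrite ?inE//.
by apply: subset_itvl; rewrite bnd_simp.
Qed.

(** Strictness replaces right-continuity of the conditional distribution function: some z < y
    already lies in the set whose infimum is taken, and monotonicity carries the level from z to
    y. *)
Lemma quantile_lt x (y : R) : (Q x < y)%R -> tau%:E <= K x `[0%R, y]%classic.
Proof.
move=> /inf_lt -/(_ (has_inf_quantile_set x).1)[z [_ tauK] zy].
exact: le_trans tauK (le_kernel_itv _ _ _ (ltW zy)).
Qed.

(** By [quantile_lt] and [quantile_le], Q < y holds exactly when some rational q < y satisfies
    [tau%:E <= K x [0, q]]. This is a countable union of superlevel sets of measurable functions. *)
Lemma measurable_quantile : measurable_fun setT Q.
Proof.
move=> _; apply: (measurability _ (RGenInftyO.measurableE R)) => //.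
move=> /= _ [_ [y ->] <-]; rewrite setTI preimage_itvNyo.
rewrite [X in measurable X](_ : _ = \bigcup_(q : rat)
    [set x | (ratr q < y)%R /\ tau%:E <= K x `[0%R, ratr q]%classic]).
  apply: bigcupT_measurable_rat => q.
  have [qy|_] := ltP (ratr q) y; last first.
    by rewrite (_ : [set _ | _] = set0)//; apply/seteqP; split => x // [].
  rewrite (_ : [set _ | _] = setT `&` [set x | tau%:E <= K x `[0%R, ratr q]%classic]).
    by apply: emeasurable_fun_c_infty => //; exact: measurable_kernel.
  by rewrite setTI; apply/seteqP; split => x // [].
apply/seteqP; split => x /=.
  move=> /rat_in_itvoo[q]; rewrite in_itv/= => /andP[Qq qy].
  by exists q => //; split => //; exact: quantile_lt.
by move=> [q _ [qy /quantile_le]] /le_lt_trans; apply.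
Qed.

End Quantile.

(** * The two inequalities *)

Lemma int_quantile_ge (R : realType) (n : nat)
    (muA : probability (n.-tuple R) R)
    (muC : probability (n.-tuple R * R)%type R)
    (K : R.-pker (n.-tuple R) ~> R) (tau : R) (tau01 : (0 < tau <= 1)%R) :
    in_copula_class muA muC -> is_markov_kernel_of muA muC K ->
  (tau / 2)%:E <= int_quantile muA K tau.
Proof.
move=> CA CK; have [K01 _] := CK.
have mQ := measurable_quantile _ _ _ _ tau01 K01.
have [tau0 tau1] := andP tau01.
apply: ge0_expectation_ge_half => //; first exact: quantile_ge0.
move=> y y0; have := markov_kernel_ge _ _ _ _ _ `[0%R, y] _ CA CK (measurable_itv _) tau0.
move=> /le_trans /(_ (unifI_le_length _ _ _ _ (ltW y0) (or_introl erefl))).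
rewrite subr0; apply: le_trans; rewrite lee_pmul2l ?lte_fin//.
apply: le_measure; rewrite ?inE; first exact: measurable_lt_cst.
  by rewrite -[X in measurable X]setTI; apply: emeasurable_fun_c_infty => //;
    exact: measurable_kernel.
by move=> x /=; exact: quantile_lt.
Qed.

Lemma int_quantile_le (R : realType) (n : nat)
    (muA : probability (n.-tuple R) R)
    (muC : probability (n.-tuple R * R)%type R)
    (K : R.-pker (n.-tuple R) ~> R) (tau : R) (tau01 : (0 < tau <= 1)%R) :
    in_copula_class muA muC -> is_markov_kernel_of muA muC K ->
  int_quantile muA K tau <= ((tau + 1) / 2)%:E.
Proof.
move=> CA CK; have [K01 _] := CK.
have mQ := measurable_quantile _ _ _ _ tau01 K01.
have Q1 x : (0 <= quantile_reg K tau x <= 1)%R.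
  by rewrite quantile_ge0// quantile_le1.
have [tau0] := andP tau01; rewrite le_eqVlt => /predU1P[tauE|tau1].
  have -> : ((tau + 1) / 2 = 1)%R by rewrite tauE; lra.
  have -> : 1%:E = \int[muA]_x (cst 1 x).
    by rewrite integral_cst//= probability_setT mule1.
  apply: ge0_le_integral => //.
  - by move=> x _; rewrite lee_fin; case/andP: (Q1 x).
  - exact/measurable_EFinP.
  - by move=> x _; rewrite lee_fin; case/andP: (Q1 x).
have -> : ((tau + 1) / 2 = 1 - (1 - tau) / 2)%R by field.
have tau'0 : (0 < 1 - tau)%R by rewrite subr_gt0.
apply: expectation_le_half => //.
move=> y y0.
have := markov_kernel_ge _ _ _ _ _ `](1 - y)%R, 1%R] _ CA CK (measurable_itv _) tau'0.
have y1 : (1 - y <= 1)%R by lra.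
move=> /le_trans /(_ (unifI_le_length _ _ _ _ y1 (or_intror erefl))).
rewrite subKr; apply: le_trans; rewrite lee_pmul2l ?lte_fin//.
apply: le_measure; rewrite ?inE.
- by apply: measurable_lt_cst; exact: measurable_funB.
- by rewrite -[X in measurable X]setTI; apply: emeasurable_fun_c_infty => //;
    exact: measurable_kernel.
- move=> x /= Qxy.
  (* Q > 1 - y leaves [0, 1 - y] with mass below tau, so of the total mass 1 on [0, 1] more than 1 -
     tau remains on ]1 - y, 1]. *)
  have Kx : K x `[0%R, (1 - y)%R]%classic < tau%:E.
    by rewrite ltNge; apply/negP => /(quantile_le _ _ _ _ tau01 K01); lra.
  rewrite EFinB leeBlDl//.
  apply: (@le_trans _ _ (K x (`[0%R, (1 - y)%R]%classic `|` `](1 - y)%R, 1%R]%classic))).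
    rewrite -(K01 x); apply: le_measure; rewrite ?inE//; first exact: measurableU.
    move=> z /=; rewrite !in_itv/= => /andP[-> ->].
    by case: (leP z (1 - y)%R); [left|right].
  by apply: le_trans (measureU2 _ _ _) _ => //; rewrite leeD2r// ltW.
Qed.

(** * Affine change of variables and the uniform law *)

(** Both sides are measures in [F], so uniqueness of Lebesgue measure reduces the claim to half-open
    intervals. *)
Lemma lebesgue_measure_affine (R : realType) (a c : R) (c0 : (0 < c)%R)
    (F : set R) : measurable F ->
  @lebesgue_measure R F =
  c%:E * @lebesgue_measure R ((fun y : R => a + c * y)%R @^-1` F).
Proof.
move=> mF; pose f (y : measurableTypeR R) : measurableTypeR R := (a + c * y)%R.
have mf : measurable_fun setT f.
  by apply: measurable_funD => //; exact: measurable_funM.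
(* The measure structure on [pushforward] depends on the proof [mf], so it is not
   inferred and has to be named. *)
pose m : {measure set (measurableTypeR R) -> \bar R} :=
  mscale (NngNum (ltW c0))
    (measure_function_pushforward__canonical__measure_function_Measure
      (@lebesgue_measure R) mf).
suff H X : ocitv X -> lebesgue_measure X = m X.
  by rewrite (@lebesgue_measure_unique R m H F mF).
move: X.
move=> _ [[x y] _ <-]/=.
rewrite /m /mscale/= /pushforward.
rewrite (_ : f @^-1` _ = `]((x - a) / c)%R, ((y - a) / c)%R]%classic); last first.
  apply/seteqP; split => z /=; rewrite !in_itv/= ltr_pdivrMr// ler_pdivlMr// /f;
    by move=> /andP[? ?]; apply/andP; split; lra.
rewrite !lebesgue_measure_itv/= !lte_fin ltr_pM2r ?invr_gt0// ltrD2r.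
case: ifPn => _; last by rewrite mule0.
by rewrite -!EFinB -EFinM; congr EFin; field; rewrite gt_eqF.
Qed.

(** Convertible to [unifI]; the form through [mrestr] inherits a measure structure, and several
    later steps pass silently from one to the other. *)
Definition unif01 (R : realType) : set (measurableTypeR R) -> \bar R :=
  mrestr (@lebesgue_measure R) (measurable_itv `[0%R, 1%R]).

HB.instance Definition _ (R : realType) := Measure.on (@unif01 R).

Lemma unif01_setT (R : realType) : @unif01 R setT = 1.
Proof. by rewrite /unif01 /mrestr setTI lebesgue_measure_itv/= lte_fin ltr01 oppr0 adde0. Qed.

HB.instance Definition _ (R : realType) :=
  @Measure_isProbability.Build _ _ R (@unif01 R) (unif01_setT R).

(** * The collapsed independence copula *)

Section Construction.
Context (R : realType) (n : nat) (i : 'I_n) (a b : R).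

(* [is_markov_kernel_of] requires mass 1 on [0, 1] at every x, hence the
   truncation of the i-th coordinate, which is almost surely in [0, 1]. *)
Definition clip (x : n.-tuple R) : R := Num.min 1%R (Num.max 0%R (tnth x i)).

Lemma measurable_clip : measurable_fun setT clip.
Proof.
apply: measurable_minr => //; apply: measurable_maxr => //.
exact: measurable_tnth.
Qed.

Definition collapse (z : n.-tuple R * R) : R :=
  if (a <= z.2 <= b)%R then (a + (b - a) * clip z.1)%R else z.2.

Lemma measurable_collapse : measurable_fun setT collapse.
Proof.
apply: measurable_fun_ifT => //.
- apply: measurable_and; first exact: measurable_fun_ler.
  exact: measurable_fun_ler.
- apply: measurable_funD => //; apply: measurable_funM => //.
  apply: (measurableT_comp measurable_clip); exact: measurable_fst.
Qed.

Definition collapsel (x : n.-tuple R) (y : measurableTypeR R) : R := collapse (x, y).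

Lemma measurable_collapsel x : measurable_fun setT (collapsel x).
Proof. exact: measurableT_comp measurable_collapse (measurable_pair1 x). Qed.

HB.instance Definition _ x :=
  isMeasurableFun.Build _ _ _ _ (collapsel x) (measurable_collapsel x).

Definition collapse_kernel (x : n.-tuple R) : {measure set R -> \bar R} :=
  distribution (@unif01 R) (collapsel x).

Lemma measurable_collapse_kernel (U : set R) : measurable U ->
  measurable_fun setT (collapse_kernel ^~ U).
Proof.
move=> mU.
have mA : measurable (collapse @^-1` U).
  by rewrite -[X in measurable X]setTI; exact: measurable_collapse.
have := measurable_fun_xsection (@unif01 R) mA.
congr (measurable_fun _ _); apply/funext => x /=; congr (unif01 _ _).
by apply/seteqP; split => y; rewrite /xsection/= inE.
Qed.

HB.instance Definition _ :=
  isKernel.Build _ _ _ _ _ collapse_kernel measurable_collapse_kernel.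

Lemma collapse_kernel_setT x : collapse_kernel x setT = 1.
Proof. exact: probability_setT. Qed.

HB.instance Definition _ :=
  Kernel_isProbability.Build _ _ _ _ _ collapse_kernel collapse_kernel_setT.

Definition collapse_pair (z : n.-tuple R * measurableTypeR R) : n.-tuple R * R :=
  (z.1, collapse z).

Lemma measurable_collapse_pair : measurable_fun setT collapse_pair.
Proof.
apply: measurable_fun_pair; first exact: measurable_fst.
exact: measurable_collapse.
Qed.

HB.instance Definition _ :=
  isMeasurableFun.Build _ _ _ _ collapse_pair measurable_collapse_pair.

Context (muA : probability (n.-tuple R) R).

Definition collapse_copula : probability (n.-tuple R * R)%type R :=
  distribution (muA \x @unif01 R) collapse_pair.

(** The product measure unfolds to the integral of the measures of sections. The section at x of the
    preimage of [B]*[F] is the preimage of [F] under [collapsel x] if x is in [B], and empty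
    otherwise. *)
Lemma collapse_copulaE (B : set (n.-tuple R)) (F : set R) :
    measurable B -> measurable F ->
  collapse_copula (B `*` F) = \int[muA]_(x in B) collapse_kernel x F.
Proof.
move=> mB mF; rewrite integral_mkcond; apply: eq_integral => x _ /=.
rewrite patchE; case: ifPn => [|]; rewrite ?inE ?notin_setE => Bx.
  by congr (unif01 _ _); apply/seteqP; split => y; rewrite /xsection/= inE => //= -[].
transitivity (unif01 R set0); last exact: measure0.
congr (unif01 _ _).
by apply/seteqP; split => y //; rewrite /xsection/= inE => -[].
Qed.

Hypothesis hA : is_copula_measure muA.

(** Truncation is the identity on [0, 1], the only part that [unifI] sees. *)
Lemma law_clip (F : set R) : measurable F ->
  muA [set x | F (clip x)] = unifI F.
Proof.
move=> mF.
pose h (y : R) : R := Num.min 1%R (Num.max 0%R y).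
have mh : measurable_fun setT h.
  by apply: measurable_minr => //; exact: measurable_maxr.
rewrite (_ : [set x | F (clip x)] = [set x | (h @^-1` F) (tnth x i)])//.
rewrite hA; last by rewrite -[X in measurable X]setTI; exact: mh.
congr (lebesgue_measure _); apply/seteqP.
by split => y [+ y01]; move: (y01); rewrite /= in_itv/= => /andP[y0 y1];
  rewrite /h (max_idPr y0) (min_idPr y1).
Qed.

Lemma clip01 x : (0 <= clip x <= 1)%R.
Proof. by rewrite /clip le_min ge_min le_max ler01 !lexx. Qed.

(** The two tail lemmas with t = 1 give matching bounds 1/2 for a uniform variable. *)
Lemma integral_clip : \int[muA]_x (clip x)%:E = (1 / 2)%:E.
Proof.
have clip0 x : (0 <= clip x)%R by case/andP: (clip01 x).
apply/eqP; rewrite eq_le; apply/andP; split.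
  rewrite (_ : 1 / 2 = 1 - 1 / 2)%R; last lra.
  apply: expectation_le_half => //; [exact: measurable_clip|exact: clip01|].
  move=> y y0; rewrite mul1e.
  rewrite (_ : [set _ | _] = [set x | `](1 - y)%R, +oo[%classic (clip x)]).
    rewrite law_clip//.
    have y1 : (1 - y <= 1)%R by lra.
    apply: le_trans (_ : unifI `](1 - y)%R, 1%R] <= _); last first.
      by apply: le_trans (unifI_le_length _ _ _ _ y1 (or_intror erefl)) _; rewrite subKr.
    apply: le_measure; rewrite ?inE; [exact: measurableI|exact: measurableI|].
    by move=> z [/=]; rewrite !in_itv/= andbT => -> /andP[-> ->].
  by apply/seteqP; split => x /=; rewrite in_itv/= andbT => ?; lra.
apply: ge0_expectation_ge_half => //; first exact: measurable_clip.
move=> y y0; rewrite mul1e.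
rewrite (_ : [set _ | _] = [set x | `]-oo, y[%classic (clip x)]).
  rewrite law_clip//.
  apply: le_trans (_ : unifI `[0%R, y] <= _); last first.
    by apply: le_trans (unifI_le_length _ _ _ _ (ltW y0) (or_introl erefl)) _; rewrite subr0.
  apply: le_measure; rewrite ?inE; [exact: measurableI|exact: measurableI|].
  by move=> z [/=]; rewrite !in_itv/= => /ltW -> /andP[-> ->].
by apply/seteqP; split => x /=; rewrite in_itv.
Qed.

Hypotheses (a0 : (0 <= a)%R) (ab : (a < b)%R) (b1 : (b <= 1)%R).

Local Notation p x := (a + (b - a) * clip x)%R.

Lemma collapse_point x : (a <= p x <= b)%R.
Proof.
have /andP[c0 c1] := clip01 x; have ba : (0 <= b - a)%R by rewrite subr_ge0 ltW.
by rewrite lerDl mulr_ge0// -lerBrDl ler_piMr.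
Qed.

Lemma unif01_itv : unif01 R `[a, b] = (b - a)%:E.
Proof.
rewrite /unif01 /mrestr setIidl.
  by rewrite lebesgue_measure_itv/= lte_fin ab EFinB.
by move=> z /=; rewrite !in_itv/= => /andP[az zb]; rewrite (le_trans a0 az) (le_trans zb b1).
Qed.

(** Points outside [a, b] stay put, while all of [a, b], of mass b - a, lands on [p x]. Hence an
    untouched part plus an atom. *)
Lemma collapse_kernelE x (F : set R) : measurable F ->
  collapse_kernel x F = unif01 R (F `\` `[a, b]) +
    (b - a)%:E * (\1_[set x | F (p x)] x)%:E.
Proof.
move=> mF; rewrite indicE; have [pF|pF] := boolP (x \in _).
  rewrite mule1 -unif01_itv -measureU//; last 2 first.
  - exact: measurableD.
  - by rewrite setDKI.
  congr (unif01 _ _); apply/seteqP; split => y /=; rewrite /collapsel /collapse/= in_itv/=.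
    by case: ifPn => _; [right|left].
  by case: ifPn => yab; [move: pF; rewrite inE|case=> -[]].
rewrite mule0 adde0; congr (unif01 _ _).
apply/seteqP; split => y /=; rewrite /collapsel /collapse/= in_itv/=.
  by case: ifPn => // _; move: pF; rewrite notin_setE.
by case: ifPn => // yab [].
Qed.

(** This is uniformity of the last marginal: averaged over x, the atom of mass b - a moves uniformly
    across [a, b] and restores exactly the mass that the collapse removed there. *)
Lemma integral_collapse_kernel (F : set R) : measurable F ->
  \int[muA]_x collapse_kernel x F = unifI F.
Proof.
move=> mF.
have mp : measurable [set x | F (p x)].
  rewrite -[X in measurable X]setTI.
  apply: (_ : measurable_fun setT (fun x => p x)) => //.
  apply: measurable_funD => //; apply: measurable_funM => //; exact: measurable_clip.
under eq_integral do rewrite collapse_kernelE//.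
have : 0 <= unif01 R (F `\` `[a, b]) by [].
move cE : (unif01 R (F `\` `[a, b])) => c c0.
have ba0 : (0 <= b - a)%R by rewrite subr_ge0 ltW.
rewrite ge0_integralD//=; last 2 first.
- by move=> x _; rewrite mule_ge0// lee_fin.
- by apply/measurable_EFinP/measurable_funM => //; exact: measurable_indic.
rewrite integral_cst//= probability_setT mule1.
rewrite ge0_integralZl//; last by apply/measurable_EFinP; exact: measurable_indic.
rewrite integral_indic// setIT.
have maff : measurable_fun setT (fun y : R => a + (b - a) * y)%R.
  by apply: measurable_funD => //; exact: measurable_funM.
transitivity (c + (b - a)%:E * unifI ((fun y : R => a + (b - a) * y)%R @^-1` F)).
  congr (_ + _ * _); rewrite -law_clip//.
  by rewrite -[X in measurable X]setTI; exact: maff.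
transitivity (c + unif01 R (F `&` `[a, b])); last first.
  rewrite -{}cE -measureU.
  - by rewrite setDE -setIUr setUC setUv setIT.
  - exact: measurableD.
  - exact: measurableI.
  - by rewrite setDE setIACA setICl setI0.
have ba : (0 < b - a)%R by rewrite subr_gt0.
congr (_ + _); rewrite /unif01 /mrestr.
rewrite (_ : F `&` `[a, b] `&` _ = F `&` `[a, b]); last first.
  apply/setIidl => z [_]; rewrite /= !in_itv/= => /andP[az zb].
  by rewrite (le_trans a0 az) (le_trans zb b1).
(* The affine map sends [0, 1] onto [a, b], so the factor b - a is absorbed by the change of
   variables. *)
rewrite (lebesgue_measure_affine _ a _ ba); last exact: measurableI.
congr (_ * lebesgue_measure _); apply/seteqP.
by split => z /= [Fz]; rewrite !in_itv/= lerDl -lerBrDl pmulr_rge0// ger_pMr.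
Qed.

Lemma collapse_copula_class : in_copula_class muA collapse_copula.
Proof.
have EB (B : set (n.-tuple R)) : measurable B -> collapse_copula (B `*` setT) = muA B.
  move=> mB; rewrite collapse_copulaE//.
  under eq_integral do rewrite collapse_kernel_setT.
  by rewrite integral_cst// mul1e.
split=> //; split => [j B mB|B mB].
  rewrite -(hA j)// -EB; last first.
    by rewrite -[X in measurable X]setTI; exact: measurable_tnth.
  by congr (collapse_copula _); apply/seteqP; split => [x|x []].
rewrite -integral_collapse_kernel// -collapse_copulaE//.
by congr (collapse_copula _); apply/seteqP; split => [x|x []].
Qed.

Lemma collapse_kernel_of : is_markov_kernel_of muA collapse_copula collapse_kernel.
Proof.
split; last by move=> B F mB mF; exact: collapse_copulaE.
move=> x; rewrite -[RHS](unif01_setT R).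
congr (lebesgue_measure _); rewrite setTI.
apply/seteqP; split => [y []//|y y01]; split => //.
rewrite /= /collapsel /collapse/=; case: ifPn => // _.
have /andP[ap pb] := collapse_point x.
by rewrite in_itv/= (le_trans a0 ap) (le_trans pb b1).
Qed.

(** The conditional distribution function is at most a < tau below [p x] and jumps to at least b >=
    tau there. *)
Lemma collapse_quantile (tau : R) x : (a < tau <= b)%R ->
  quantile_reg collapse_kernel tau x = p x.
Proof.
move=> /andP[atau taub].
have /andP[ap pb] := collapse_point x.
have [K01 _] := collapse_kernel_of.
have tau01 : (0 < tau <= 1)%R.
  by rewrite (le_lt_trans a0 atau) (le_trans taub b1).
apply/eqP; rewrite eq_le; apply/andP; split.
  apply: (quantile_le _ _ _ _ tau01 K01).
  (* Every y in [0, b] is sent into [0, p x], so this interval has mass at least b. *)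
  apply: (@le_trans _ _ (unifI `[0%R, b])).
    rewrite /unifI setIidl; last first.
      by apply: subset_itvl; rewrite bnd_simp.
    rewrite lebesgue_measure_itv/= lte_fin (le_lt_trans a0 ab) oppr0 addr0.
    by rewrite lee_fin.
  apply: le_measure; rewrite ?inE.
  - exact: measurableI.
  - apply: measurableI => //; rewrite -[X in measurable X]setTI.
    exact: measurable_collapsel.
  - move=> y [/=]; rewrite !in_itv/= => /andP[y0 yb] y01; split => //.
    rewrite /collapsel /collapse/=; case: ifPn => [_|].
      by rewrite lexx (le_trans a0 ap).
    rewrite yb andbT -ltNge => ya.
    by rewrite y0 (le_trans (ltW ya) ap).
rewrite leNgt; apply/negP => Qp.
(* For the midpoint m of Q and [p x], the mass of [0, m] should reach tau by [quantile_lt]. As m < p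
   x, only points y < a are sent there, so the mass is at most a. *)
have [Qm mp] := midf_lt Qp; move: mp; set m := (_ / 2)%R => mp.
have := quantile_lt _ _ _ _ tau01 K01 _ _ Qm; rewrite leNgt => /negP; apply.
apply: (@le_lt_trans _ _ (unifI `[0%R, a])); last first.
  apply: le_lt_trans (unifI_le_length _ _ _ _ a0 (or_introl erefl)) _.
  by rewrite subr0 lte_fin.
rewrite [leLHS](_ : _ = unifI (collapsel x @^-1` `[0%R, m]%classic))//.
apply: le_measure; rewrite ?inE.
- apply: measurableI => //; rewrite -[X in measurable X]setTI.
  exact: measurable_collapsel.
- exact: measurableI.
- move=> y [/=]; rewrite /collapsel /collapse/=; case: ifPn => [_|].
    by rewrite !in_itv/= => /andP[_ /le_lt_trans/(_ mp)]; rewrite ltxx.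
  rewrite !in_itv/= negb_and -!ltNge => /orP[ya|yb] /andP[y0 ym] y01; split => //.
    by rewrite y0 ltW.
  by have := le_lt_trans ym mp; rewrite ltNge (le_trans pb (ltW yb)).
Qed.

Lemma int_quantile_collapse (tau : R) : (a < tau <= b)%R ->
  int_quantile muA collapse_kernel tau = ((a + b) / 2)%:E.
Proof.
move=> tauab; rewrite /int_quantile.
under eq_integral do rewrite collapse_quantile// EFinD EFinM.
have clip0 x : (0 <= clip x)%R by case/andP: (clip01 x).
have ba0 : (0 <= b - a)%R by rewrite subr_ge0 ltW.
have mc : measurable_fun setT (fun x => (clip x)%:E).
  by apply/measurable_EFinP; exact: measurable_clip.
rewrite ge0_integralD//=; last 2 first.
- by move=> x _; rewrite mule_ge0// lee_fin.
- exact: measurable_funeM.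
rewrite integral_cst//= probability_setT mule1.
rewrite ge0_integralZl//; last by move=> x _; rewrite lee_fin.
transitivity (a%:E + (b - a)%:E * (1 / 2)%:E).
  by congr (_ + _ * _); exact: integral_clip.
by rewrite -EFinM -EFinD; congr EFin; field.
Qed.

End Construction.

(** * The bounds and their sharpness *)

Theorem theorem19 (R : realType) (d : nat) (hd : (2 <= d)%N)
    (muA : probability (d.-1.-tuple R) R) (hA : is_copula_measure muA)
    (tau : R) (htau : (0 < tau <= 1)%R) :
  (forall (muC : probability (d.-1.-tuple R * R)%type R)
          (K : R.-pker (d.-1.-tuple R) ~> R),
      in_copula_class muA muC -> is_markov_kernel_of muA muC K ->
      (tau / 2)%:E <= int_quantile muA K tau <= ((tau + 1) / 2)%:E) /\
  ereal_inf [set v | exists (muC : probability (d.-1.-tuple R * R)%type R)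
                            (K : R.-pker (d.-1.-tuple R) ~> R),
                in_copula_class muA muC /\ is_markov_kernel_of muA muC K /\
                v = int_quantile muA K tau] = (tau / 2)%:E /\
  ereal_sup [set v | exists (muC : probability (d.-1.-tuple R * R)%type R)
                            (K : R.-pker (d.-1.-tuple R) ~> R),
                in_copula_class muA muC /\ is_markov_kernel_of muA muC K /\
                v = int_quantile muA K tau] = ((tau + 1) / 2)%:E.
Proof.
have bounds (muC : probability (d.-1.-tuple R * R)%type R)
    (K : R.-pker (d.-1.-tuple R) ~> R) :
    in_copula_class muA muC -> is_markov_kernel_of muA muC K ->
    (tau / 2)%:E <= int_quantile muA K tau <= ((tau + 1) / 2)%:E.
  move=> CA CK; apply/andP; split.
    exact: (@int_quantile_ge _ _ _ _ _ _ htau CA CK).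
  exact: (@int_quantile_le _ _ _ _ _ _ htau CA CK).
have [tau0 tau1] := andP htau.
(* Since d >= 2 there is a coordinate to drive the collapse point. *)
have i : 'I_d.-1 by apply: (@Ordinal _ 0); case: d hd {muA hA bounds} => [|[]].
have attained (a b : R) : (0 <= a)%R -> (a < tau)%R -> (tau <= b)%R -> (b <= 1)%R ->
    exists (muC : probability (d.-1.-tuple R * R)%type R)
           (K : R.-pker (d.-1.-tuple R) ~> R),
    in_copula_class muA muC /\ is_markov_kernel_of muA muC K /\
    ((a + b) / 2)%:E = int_quantile muA K tau.
  move=> a0 atau taub b1; have ab := lt_le_trans atau taub.
  exists (collapse_copula _ _ i a b muA), (collapse_kernel _ _ i a b).
  split; first exact: collapse_copula_class.
  split; first exact: collapse_kernel_of.
  by rewrite int_quantile_collapse// atau.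
split=> //; split; apply/eqP; rewrite eq_le; apply/andP; split.
(* Reading tau as 0 + tau selects the witness a = 0, b = tau. *)
- apply: ereal_inf_lbound; rewrite -[X in (X / 2)%R]add0r.
  exact: attained.
- by apply: le_ereal_inf_tmp => _ [muC [K [CA [CK ->]]]]; case/andP: (bounds _ _ CA CK).
- by apply: ge_ereal_sup => _ [muC [K [CA [CK ->]]]]; case/andP: (bounds _ _ CA CK).
- apply/lee_subgt0Pr => e e0; rewrite -EFinB.
  (* The maximum keeps a >= 0, and a < tau because both tau and e are positive. With b = 1 the mean
     (a + 1) / 2 falls short of the bound by at most e / 2. *)
  pose a : R := Num.max 0%R (tau - e)%R.
  apply: (@le_trans _ _ ((a + 1) / 2)%:E).
    have : (tau - e <= a)%R by rewrite /a le_max lexx orbT.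
    by rewrite lee_fin => ?; lra.
  apply: ereal_sup_ubound; apply: attained => //.
    by rewrite /a le_max lexx.
  by rewrite /a gt_max tau0 ltrBlDr ltrDl.
Qed.
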